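(* Let $m,n,k\ge1$ be integers, let $A_1,\dots,A_k,\widetilde A_1,\dots,\widetilde A_k\in\mathbb{R}^{m\times n}$, and let $M=[A_1,\dots,A_k]$, $\widetilde M=[\widetilde A_1,\dots,\widetilde A_k]\in\mathbb{R}^{m\times kn}$ be the horizontal concatenations. Set $E_i=\widetilde A_i-A_i$ for $i=1,\dots,k$. Then the matrix $D=\widetilde M\widetilde M^T-MM^T$ satisfies \[ \|D\|_2\le\sum_{i=1}^k\bigl(2\|A_i\|_2\|E_i\|_2+\|E_i\|_2^2\bigr). \]
   Context: $\|\cdot\|_2$ denotes the spectral (operator) norm of a matrix. *)

(* Defs.v *)
From mathcomp Require Import all_boot all_order all_algebra.
From mathcomp Require Import boolp classical_sets reals.

Set Implicit Arguments.
Unset Strict Implicit.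
Unset Printing Implicit Defensive.

Import Order.TTheory GRing.Theory Num.Theory.

Local Open Scope classical_set_scope.
Local Open Scope ring_scope.

(* The norm that MathComp-Analysis attaches to matrices is the entrywise
   maximum, hence the separate definition of the Euclidean norm. *)
Definition norm2 (R : realType) (n : nat) (x : 'cV[R]_n) : R :=
  Num.sqrt (\sum_(i < n) x i 0 ^+ 2).

(* The supremum is over the closed unit ball rather than the unit sphere, so
   that the set is nonempty also when [n] is 0. *)
Definition opnorm2 (R : realType) (m n : nat) (A : 'M[R]_(m, n)) : R :=
  sup [set norm2 (A *m x) | x in [set x : 'cV[R]_n | norm2 x <= 1]].

(* [sup] is 0 on a set that is empty or unbounded; this never happens here. *)
Lemma opnorm2_has_sup (R : realType) (m n : nat) (A : 'M[R]_(m, n)) :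
  has_sup [set norm2 (A *m x) | x in [set x : 'cV[R]_n | norm2 x <= 1]].
Proof.
split.
  exists (norm2 (A *m 0)); exists 0 => //=.
  by rewrite /norm2 big1 ?sqrtr0 ?ler01// => i _; rewrite mxE expr0n.
exists (Num.sqrt (\sum_(i < m) (\sum_(j < n) `|A i j|) ^+ 2)) => _ [x /= x1 <-].
have xj j : `|x j 0| <= 1.
  apply: le_trans x1; rewrite -sqrtr_sqr; apply: ler_wsqrtr.
  by rewrite (bigD1 j)//= lerDl sumr_ge0// => i _; rewrite sqr_ge0.
apply: ler_wsqrtr; apply: ler_sum => i _.
rewrite -real_normK ?num_real// lerXn2r ?nnegrE ?sumr_ge0// mxE.
apply: le_trans (ler_norm_sum _ _ _) _; apply: ler_sum => j _.
by rewrite normrM ler_piMr.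
Qed.

(* Main.v *)
(** Blockwise, [D] is the sum of the [A_i E_i^T + E_i A_i^T + E_i E_i^T], and the
    spectral norm is subadditive, submultiplicative and invariant under
    transposition. *)
Require Import Defs.
From mathcomp Require Import all_boot all_order all_algebra.
From mathcomp Require Import boolp classical_sets reals.
From mathcomp Require Import ring lra.

Import Order.TTheory GRing.Theory Num.Theory.

Local Open Scope ring_scope.

(** A row of blocks times its transpose is the sum of the block products, so [D] is the sum of the
    [A' i *m (A' i)^T - A i *m (A i)^T]. Putting [A' i = A i + E i] cancels [A i *m (A i)^T]; each
    of the two cross terms left has norm at most [opnorm2 (A i) * opnorm2 (E i)], and the quadratic
    one at most [opnorm2 (E i) ^+ 2]. The norm facts behind this are [ler_opnorm2_sum] and
    [ler_opnorm2_mul_tr]; Cauchy-Schwarz supplies both the triangle inequality and the bound on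
    transposes. *)

Lemma norm2_ge0 (R : realType) (n : nat) (x : 'cV[R]_n) : 0 <= norm2 x.
Proof. exact: sqrtr_ge0. Qed.

Lemma sqr_norm2 (R : realType) (n : nat) (x : 'cV[R]_n) :
  norm2 x ^+ 2 = (x^T *m x) 0 0.
Proof.
rewrite sqr_sqrtr; last by apply: sumr_ge0 => i _; rewrite sqr_ge0.
by rewrite mxE; apply: eq_bigr => i _; rewrite mxE expr2.
Qed.

Lemma norm2_eq0 (R : realType) (n : nat) (x : 'cV[R]_n) :
  (norm2 x == 0) = (x == 0).
Proof.
apply/eqP/eqP => [x0|->]; last first.
  by rewrite /norm2 big1 ?sqrtr0// => i _; rewrite mxE expr0n.
have /eqP : \sum_(i < n) x i 0 ^+ 2 = 0.
  apply/eqP; rewrite eq_le sumr_ge0 ?andbT; last by move=> i _; rewrite sqr_ge0.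
  by rewrite -sqrtr_eq0 -/(norm2 x) x0.
rewrite psumr_eq0 => [/allP x0'|i _]; last exact: sqr_ge0.
apply/matrixP => i j; rewrite ord1 mxE; apply/eqP.
by have := x0' i (mem_index_enum i); rewrite sqrf_eq0.
Qed.

Lemma norm20 (R : realType) (n : nat) : norm2 (0 : 'cV[R]_n) = 0.
Proof. by apply/eqP; rewrite norm2_eq0. Qed.

Lemma norm2Z (R : realType) (n : nat) (a : R) (x : 'cV[R]_n) :
  norm2 (a *: x) = `|a| * norm2 x.
Proof.
rewrite /norm2 -sqrtr_sqr -sqrtrM ?sqr_ge0// mulr_sumr; congr Num.sqrt.
by apply: eq_bigr => i _; rewrite mxE exprMn.
Qed.

Lemma dotmxC (R : realType) (n : nat) (x y : 'cV[R]_n) :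
  (x^T *m y) 0 0 = (y^T *m x) 0 0.
Proof. by rewrite -[in LHS](trmxK y) -trmx_mul mxE. Qed.

Lemma sqr_norm2D (R : realType) (n : nat) (x y : 'cV[R]_n) :
  norm2 (x + y) ^+ 2 = norm2 x ^+ 2 + 2 * (x^T *m y) 0 0 + norm2 y ^+ 2.
Proof.
rewrite !sqr_norm2 (linearD trmx) mulmxDl !mulmxDr [in LHS]mxE.
rewrite ![(_ *m _ + _ *m _) 0 0]mxE.
by rewrite (dotmxC _ _ y x); ring.
Qed.

(** With [a = norm2 x] and [b = norm2 y], expanding the square of the norm of [b x - a y] gives
    [2 a b (a b - <x, y>) >= 0], and [a b > 0] can be cancelled once [x] and [y] are nonzero. *)
Lemma cauchy_schwarz_norm2 (R : realType) (n : nat) (x y : 'cV[R]_n) :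
  (x^T *m y) 0 0 <= norm2 x * norm2 y.
Proof.
have [->|x0] := eqVneq x 0; first by rewrite trmx0 mul0mx mxE norm20 mul0r.
have [->|y0] := eqVneq y 0; first by rewrite mulmx0 mxE norm20 mulr0.
have xgt0 : 0 < norm2 x by rewrite lt_def norm2_eq0 x0 norm2_ge0.
have ygt0 : 0 < norm2 y by rewrite lt_def norm2_eq0 y0 norm2_ge0.
have := sqr_ge0 (norm2 (norm2 y *: x + (- norm2 x) *: y)).
rewrite sqr_norm2D !norm2Z normrN !ger0_norm ?norm2_ge0//.
rewrite [(_ *: x)^T]linearZ /= -scalemxAl -scalemxAr !mxE => h.
rewrite -subr_ge0 -(pmulr_rge0 _ (mulr_gt0 xgt0 ygt0)).
nra.
Qed.

Lemma ler_norm2D (R : realType) (n : nat) (x y : 'cV[R]_n) :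
  norm2 (x + y) <= norm2 x + norm2 y.
Proof.
rewrite -(@ler_pXn2r _ 2) ?nnegrE ?addr_ge0 ?norm2_ge0//.
rewrite sqr_norm2D; have := cauchy_schwarz_norm2 _ _ x y; nra.
Qed.

Lemma opnorm2_ge0 (R : realType) (m n : nat) (A : 'M[R]_(m, n)) :
  0 <= opnorm2 A.
Proof.
apply: (ub_le_sup (opnorm2_has_sup A).2).
by exists 0; rewrite /= ?mulmx0 norm20.
Qed.

(** For nonzero [x], the vector [x / norm2 x] lies in the unit ball; homogeneity carries its bound
    back to [x]. *)
Lemma norm2_mulmx (R : realType) (m n : nat) (A : 'M[R]_(m, n)) (x : 'cV[R]_n) :
  norm2 (A *m x) <= opnorm2 A * norm2 x.
Proof.
have [->|x0] := eqVneq x 0; first by rewrite mulmx0 !norm20 mulr0.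
have xgt0 : 0 < norm2 x by rewrite lt_def norm2_eq0 x0 norm2_ge0.
have vx : `|(norm2 x)^-1| = (norm2 x)^-1 by rewrite ger0_norm ?invr_ge0 ?norm2_ge0.
rewrite -ler_pdivrMr// mulrC -vx -norm2Z scalemxAr.
apply: (ub_le_sup (opnorm2_has_sup A).2).
by exists ((norm2 x)^-1 *: x); rewrite //= norm2Z vx mulVf ?gt_eqF.
Qed.

(** Together with [norm2_mulmx], this makes [opnorm2 A] the least nonnegative [c] with
    [norm2 (A *m x) <= c * norm2 x] for all [x]; the bounds below rest on this and no longer unfold
    the supremum. *)
Lemma opnorm2_le (R : realType) (m n : nat) (A : 'M[R]_(m, n)) (c : R) :
  0 <= c -> (forall x : 'cV[R]_n, norm2 (A *m x) <= c * norm2 x) ->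
  opnorm2 A <= c.
Proof.
move=> c0 Ac; apply: ge_sup; first exact: (opnorm2_has_sup A).1.
by move=> _ [x /= x1 <-]; apply: le_trans (Ac x) _; rewrite ler_piMr.
Qed.

Lemma opnorm20 (R : realType) (m n : nat) : opnorm2 (0 : 'M[R]_(m, n)) = 0.
Proof.
apply/eqP; rewrite eq_le opnorm2_ge0 andbT; apply: opnorm2_le => // x.
by rewrite mul0mx norm20 mul0r.
Qed.

Lemma ler_opnorm2D (R : realType) (m n : nat) (A B : 'M[R]_(m, n)) :
  opnorm2 (A + B) <= opnorm2 A + opnorm2 B.
Proof.
apply: opnorm2_le => [|x]; first by rewrite addr_ge0 ?opnorm2_ge0.
by rewrite mulmxDl mulrDl (le_trans (ler_norm2D _ _ _ _))// lerD ?norm2_mulmx.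
Qed.

Lemma ler_opnorm2_sum (R : realType) (m n k : nat) (A : 'I_k -> 'M[R]_(m, n)) :
  opnorm2 (\sum_(i < k) A i) <= \sum_(i < k) opnorm2 (A i).
Proof.
elim/big_ind2 : _ => [|B b C c Bb Cc|//]; first by rewrite opnorm20.
exact: le_trans (ler_opnorm2D _ _ _ _ _) (lerD Bb Cc).
Qed.

Lemma ler_opnorm2M (R : realType) (m n p : nat)
    (A : 'M[R]_(m, n)) (B : 'M[R]_(n, p)) :
  opnorm2 (A *m B) <= opnorm2 A * opnorm2 B.
Proof.
apply: opnorm2_le => [|x]; first by rewrite mulr_ge0 ?opnorm2_ge0.
rewrite -mulmxA -mulrA (le_trans (norm2_mulmx _ _ _ _ _))//.
by rewrite ler_wpM2l ?opnorm2_ge0 ?norm2_mulmx.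
Qed.

Lemma ler_opnorm2_tr (R : realType) (m n : nat) (A : 'M[R]_(m, n)) :
  opnorm2 A^T <= opnorm2 A.
Proof.
apply: opnorm2_le => [|x]; first exact: opnorm2_ge0.
(* The estimate below is quadratic in [norm2 (A^T *m x)]; one factor is to be cancelled, so it must
   be nonzero. *)
have [->|y0] := eqVneq (A^T *m x) 0.
  by rewrite norm20 mulr_ge0 ?opnorm2_ge0 ?norm2_ge0.
have ygt0 : 0 < norm2 (A^T *m x) by rewrite lt_def norm2_eq0 y0 norm2_ge0.
(* |A^T x|^2 = <x, A A^T x> <= |x| |A| |A^T x| *)
rewrite -(ler_pM2r ygt0) -expr2 sqr_norm2 trmx_mul trmxK -mulmxA.
apply: le_trans (cauchy_schwarz_norm2 _ _ _ _) _.
by rewrite [leRHS]mulrAC mulrC ler_wpM2r ?norm2_ge0 ?norm2_mulmx.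
Qed.

(** Every term in the blockwise expansion of [D] has this shape. *)
Lemma ler_opnorm2_mul_tr (R : realType) (m n p : nat)
    (A : 'M[R]_(m, n)) (B : 'M[R]_(p, n)) :
  opnorm2 (A *m B^T) <= opnorm2 A * opnorm2 B.
Proof.
apply: le_trans (ler_opnorm2M _ _ _ _ _ _) _.
by rewrite ler_wpM2l ?opnorm2_ge0 ?ler_opnorm2_tr.
Qed.

Theorem lemma2 (R : realType) (m n k : nat)
    (m_ge1 : (1 <= m)%N) (n_ge1 : (1 <= n)%N) (k_ge1 : (1 <= k)%N)
    (A A' : 'I_k -> 'M[R]_(m, n)) :
  let M : 'M[R]_(m, \sum_(i < k) n) := \mxrow_(i < k) A i in
  let M' : 'M[R]_(m, \sum_(i < k) n) := \mxrow_(i < k) A' i in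
  let E : 'I_k -> 'M[R]_(m, n) := fun i => A' i - A i in
  let D : 'M[R]_m := M' *m M'^T - M *m M^T in
  is_true (opnorm2 D <=
    \sum_(i < k) (2 * opnorm2 (A i) * opnorm2 (E i) + opnorm2 (E i) ^+ 2)).
Proof.
move=> M M' E D.
have -> : D = \sum_(i < k) (A i *m (E i)^T + E i *m (A i)^T + E i *m (E i)^T).
  rewrite /D /M /M' !tr_mxrow !mul_mxrow_mxcol -sumrB.
  apply: eq_bigr => i _; have -> : A' i = A i + E i by rewrite /E addrC subrK.
  by rewrite (linearD trmx) mulmxDl !mulmxDr addrAC [_ + _ - _]addrAC subrr add0r addrA.
apply: le_trans (ler_opnorm2_sum _ _ _ _ _) _; apply: ler_sum => i _.
have AE := ler_opnorm2_mul_tr _ _ _ _ (A i) (E i).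
have EA := ler_opnorm2_mul_tr _ _ _ _ (E i) (A i).
have EE := ler_opnorm2_mul_tr _ _ _ _ (E i) (E i).
have D1 := ler_opnorm2D _ _ _ (A i *m (E i)^T + E i *m (A i)^T) (E i *m (E i)^T).
have D2 := ler_opnorm2D _ _ _ (A i *m (E i)^T) (E i *m (A i)^T).
(* [AE] and [EA] give the same bound up to commutativity, whence the factor 2; [EE] gives the
   square. *)
nra.
Qed.
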